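(* Let $N\ge 1$ and $s\ge 1$ be integers, let $G=\mathbb{Z}/N\mathbb{Z}$, let $\Omega$ be a non-empty subset of $\hat G=\mathbb{Z}/N\mathbb{Z}$, and put $$K(t)=\sum_{\omega\in\Omega} e\Big(\frac{\omega t}{N}\Big)\qquad (t\in G).$$ Suppose that $|K(t)|<\frac{1}{2s}K(0)$ for every $t\in G$, $t\neq 0$. Then every function $x:G\to\mathbb{C}$ carried by a set of $s$ points of $G$ has property (i): for every $y:G\to\mathbb{C}$ with $y\ne x$ and $\hat y|_\Omega=\hat x|_\Omega$ one has $\|y\|_1>\|x\|_1$.
   Context: $e(u)=\exp(2\pi i u)$. For $x:G\to\mathbb{C}$, $\|x\|_1=\sum_{t\in G}|x(t)|$ and the Fourier transform is $\hat x(\omega)=\frac{1}{\sqrt N}\sum_{t\in G}x(t)e(-t\omega/N)$ for $\omega\in\hat G=\mathbb{Z}/N\mathbb{Z}$. A function $x$ is carried by $S\subset G$ if $x(t)=0$ for all $t\in G\setminus S$. Property (i) says that $\hat x$ is the unique extension of $\hat x|_\Omega$ of minimal norm in the Wiener algebra of $\hat G$, where $\|\hat x\|_A=\|x\|_1$. *)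

(* Defs.v *)
From HB Require Import structures.
From mathcomp Require Import all_boot all_order all_algebra.
From mathcomp Require Import all_classical all_reals all_analysis.
From mathcomp Require Import complex.

Set Implicit Arguments.
Unset Strict Implicit.
Unset Printing Implicit Defensive.

Import Order.TTheory GRing.Theory Num.Theory.

Local Open Scope ring_scope.
Local Open Scope complex_scope.

(* Z/NZ, N >= 1, is the additive group
   'I_m.+1 with N = m.+1; the complex numbers are R[i], where `|z| is a real
   element of R[i], and z < w means that w - z is real and positive. *)

(* e(u) = exp(2 pi i u) *)
Definition e (R : realType) (u : R) : R[i] :=
  cos (2 * pi * u) +i* sin (2 * pi * u).

(* In [fourier] and [spectral_kernel] the products t * w are taken in nat on the
   representatives in {0, ..., m}: e (k / N) depends only on k modulo N. *)
Definition fourier (R : realType) (m : nat) (x : {ffun 'I_m.+1 -> R[i]})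
    (w : 'I_m.+1) : R[i] :=
  ((Num.sqrt (m.+1%:R : R))^-1)%:C *
  \sum_(t : 'I_m.+1) x t * e (- (t * w)%N%:R / m.+1%:R).

Definition l1norm (R : realType) (m : nat) (x : {ffun 'I_m.+1 -> R[i]}) : R[i] :=
  \sum_(t : 'I_m.+1) `|x t|.

Definition carried_by (R : realType) (m : nat) (x : {ffun 'I_m.+1 -> R[i]})
    (S : {set 'I_m.+1}) : Prop :=
  forall t : 'I_m.+1, t \notin S -> x t = 0.

Definition spectral_kernel (R : realType) (m : nat) (Omega : {set 'I_m.+1})
    (t : 'I_m.+1) : R[i] :=
  \sum_(w in Omega) e ((w * t)%N%:R / m.+1%:R).

(* The Wiener algebra norm of [fourier x] is [l1norm x]; since the Fourier
   transform is bijective, the extensions of the restriction of [fourier x] to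
   Omega are the functions [fourier y] below. *)
Definition unique_minimal_extension (R : realType) (m : nat)
    (Omega : {set 'I_m.+1}) (x : {ffun 'I_m.+1 -> R[i]}) : Prop :=
  forall y : {ffun 'I_m.+1 -> R[i]},
    y <> x ->
    (forall w : 'I_m.+1, w \in Omega -> fourier y w = fourier x w) ->
    l1norm x < l1norm y.

(* Main.v *)
Require Import Defs.
From HB Require Import structures.
From mathcomp Require Import all_boot all_order all_algebra.
From mathcomp Require Import all_classical all_reals all_analysis.
From mathcomp Require Import complex.
From mathcomp Require Import ring.

Set Implicit Arguments.
Unset Strict Implicit.
Unset Printing Implicit Defensive.

Import Order.TTheory GRing.Theory Num.Theory.

Local Open Scope ring_scope.
Local Open Scope complex_scope.

(** If [z = y - x] has a Fourier transform vanishing on Omega, then [z * K = 0],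
    so at each point [K 0 * |z t|] is at most the sum over [u <> t] of
    [|z u| * |K (t - u)|], whence [2 s |z t| <= \sum_(u <> t) |z u|].  Summing
    over a set S of s points shows that [z] has more l1-mass outside S than on S
    (the null space property), and the triangle inequality concludes. *)

Lemma eD (R : realType) (u v : R) : e (u + v) = e u * e v.
Proof.
rewrite /e mulrDr cosD sinD; apply/eqP.
by rewrite eq_complex /= [X in _ && (X == _)]addrC !eqxx.
Qed.

Lemma e_nat (R : realType) (n : nat) : e (n%:R : R) = 1.
Proof.
rewrite /e -[2 * pi * _]add0r mulr_natr mulr_natl.
by rewrite (periodicn (@cosD2pi R)) (periodicn (@sinD2pi R)) cos0 sin0.
Qed.

(** Separates [t] from [u], so that a convolution with the kernel splits into Fourier sums. The
    subtraction in ['I_m.+1] may wrap around, which changes the argument of [e] only by an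
    integer. *)
Lemma e_sub (R : realType) (m : nat) (w t u : 'I_m.+1) :
  e ((w * (t - u)%R)%N%:R / m.+1%:R : R) =
  e ((w * t)%N%:R / m.+1%:R) * e (- (u * w)%N%:R / m.+1%:R).
Proof.
have N0 : m.+1%:R != 0 :> R by rewrite pnatr_eq0.
have : ((t - u)%R + u)%N = t %[mod m.+1].
  by rewrite [RHS]modn_small //; have /(congr1 val) := subrK u t.
move: (nat_of_ord (t - u)) => v vE.
have -> : (t : nat) = ((v + u) %% m.+1)%N by rewrite vE modn_small.
(* The inserted factor 1 is [e] of [w] times the wrap-around quotient of [v + u]; with it the two
   arguments of [e] agree exactly. *)
rewrite -eD -[RHS]mulr1 -[in RHS](e_nat R (w * ((v + u) %/ m.+1))) -eD.
congr e; apply: (mulIf N0); rewrite !mulrDl !divfK //.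
have /(congr1 (fun n => n%:R : R)) := divn_eq (v + u) m.+1.
rewrite !natrD !natrM => /(canRL (addrK _)) ->.
by ring.
Qed.

Lemma spectral_kernel0 (R : realType) (m : nat) (Omega : {set 'I_m.+1}) :
  spectral_kernel R Omega 0 = #|Omega|%:R.
Proof.
rewrite /spectral_kernel (eq_bigr (fun=> 1)) ?sumr_const // => w _.
by rewrite /= muln0 mul0r (e_nat R 0).
Qed.

(** After exchanging the sums, each frequency [w] in [Omega] contributes a multiple of
    [fourier z w]. *)
Lemma fourier_eq0_convolution (R : realType) (m : nat) (Omega : {set 'I_m.+1})
    (z : {ffun 'I_m.+1 -> R[i]}) :
  (forall w, w \in Omega -> fourier z w = 0) ->
  forall t, \sum_u z u * spectral_kernel R Omega (t - u) = 0.
Proof.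
move=> z0 t; rewrite /spectral_kernel.
under eq_bigr do rewrite mulr_sumr.
rewrite exchange_big /= big1 // => w /z0 /eqP.
rewrite /fourier mulf_eq0 => /orP[|/eqP zw].
  by rewrite fmorph_eq0 invr_eq0 sqrtr_eq0 leNgt ltr0Sn.
under eq_bigr do rewrite e_sub mulrCA.
by rewrite -mulr_sumr zw mulr0.
Qed.

Lemma fourierB (R : realType) (m : nat) (x y : {ffun 'I_m.+1 -> R[i]}) w :
  fourier (y - x) w = fourier y w - fourier x w.
Proof.
rewrite /fourier -mulrBr -sumrB; congr (_ * _).
by apply: eq_bigr => t _; rewrite !ffunE mulrBl.
Qed.

Lemma coherence_bound (R : realType) (m s : nat) (Omega : {set 'I_m.+1})
    (z : {ffun 'I_m.+1 -> R[i]}) :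
  (0 < s)%N -> Omega != finset.set0 ->
  (forall t, t != 0 ->
     `|spectral_kernel R Omega t| <= (2 * s%:R)^-1 * spectral_kernel R Omega 0) ->
  (forall w, w \in Omega -> fourier z w = 0) ->
  forall t, (2 * s%:R) * `|z t| <= \sum_(u | u != t) `|z u|.
Proof.
move=> s0 O0 hK z0 t; set K := spectral_kernel R Omega in hK *.
have K0 : 0 < K 0 by rewrite /K spectral_kernel0 ltr0n card_gt0.
have c0 : 0 < 2 * s%:R :> R[i] by rewrite mulr_gt0 ?ltr0n.
have := fourier_eq0_convolution z0 t.
rewrite (bigD1 t) //= subrr -/(K 0) => /eqP; rewrite addr_eq0 => /eqP zt.
(* Since [K 0] is positive, it can be moved inside the norm, where [zt] replaces [z t * K 0] by
   minus the sum over [u != t]. *)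
rewrite -(ler_pM2r K0) -(mulrA (2 * s%:R)) -{1}(gtr0_norm K0) -normrM zt normrN.
rewrite -ler_pdivlMl // mulrCA mulr_suml.
apply: le_trans (ler_norm_sum _ _ _) _; apply: ler_sum => u ut.
by rewrite normrM ler_wpM2l // hK // subr_eq0 eq_sym.
Qed.

(** Let A and B be the masses on and off [S], and s the cardinality of [S]. Adding [|z t|] to both
    sides makes the right side A + B; summing over [S] gives (2s + 1) A <= s (A + B), that is (s +
    1) A <= s B. If B <= A, this forces A <= 0, hence z = 0. *)
Lemma null_space_property (C : numDomainType) (I : finType) (S : {set I})
    (z : I -> C) :
  (forall t, (2 * #|S|%:R) * `|z t| <= \sum_(u | u != t) `|z u|) ->
  (exists t, z t != 0) ->
  \sum_(t in S) `|z t| < \sum_(t | t \notin S) `|z t|.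
Proof.
move=> hz [t0 zt0].
set A := \sum_(t in S) _; set B := \sum_(t | _) _.
have AB : \sum_t `|z t| = A + B by rewrite (bigID (mem S)).
have A0 : 0 <= A by apply: sumr_ge0.
have B0 : 0 <= B by apply: sumr_ge0.
have AB0 : 0 < A + B.
  by rewrite -AB (bigD1 t0) //= ltr_wpDr ?normr_gt0 // sumr_ge0.
have : (2 * #|S|%:R) * A + A <= #|S|%:R * (A + B).
  rewrite /A mulr_sumr -big_split /= -AB [leRHS]mulr_natl -[leRHS]sumr_const.
  by apply: ler_sum => t _; rewrite [leRHS](bigD1 t) //= addrC lerD2l.
have -> : (2 * #|S|%:R) * A + A = #|S|%:R * (A + A) + A by ring.
rewrite !mulrDr -addrA lerD2l => AB'.
(* The order of [C] may be partial; A and B are comparable because both are nonnegative. *)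
rewrite real_ltNge ?ger0_real //; apply/negP => BA.
have : #|S|%:R * A + A <= #|S|%:R * A + 0.
  by rewrite addr0 (le_trans AB') // ler_wpM2l.
rewrite lerD2l => A_le0.
have : A + B <= 0 + 0 by rewrite lerD // (le_trans BA).
by rewrite addr0 lt_geF.
Qed.

(** Adding [z] lowers the mass on [S] by at most the mass of [z] there, while off [S], where [x]
    vanishes, it adds the full mass of [z]. *)
Lemma ltr_sum_normD (C : numDomainType) (I : finType) (S : {set I})
    (x z : I -> C) :
  (forall t, t \notin S -> x t = 0) ->
  \sum_(t in S) `|z t| < \sum_(t | t \notin S) `|z t| ->
  \sum_t `|x t| < \sum_t `|x t + z t|.
Proof.
move=> xS zS; rewrite (bigID (mem S)) /= [X in _ + X]big1; last first.
  by move=> t /xS ->; rewrite normr0.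
rewrite addr0 [ltRHS](bigID (mem S)) /=.
rewrite [X in _ < _ + X](eq_bigr (fun t => `|z t|)); last first.
  by move=> t /xS ->; rewrite add0r.
apply: le_lt_trans (_ : \sum_(t in S) `|x t + z t| + \sum_(t in S) `|z t| < _).
  rewrite -big_split; apply: ler_sum => t _ /=.
  by rewrite -[in leLHS](addrK (z t) (x t)) ler_normB.
by rewrite ltrD2l.
Qed.

Theorem mainTheorem1 (R : realType) (m s : nat) (hs : (1 <= s)%N)
    (Omega : {set 'I_m.+1}) (hOmega : Omega != finset.set0)
    (hK : forall t : 'I_m.+1, t != 0 ->
       `|spectral_kernel R Omega t| < (2 * s%:R)^-1 * spectral_kernel R Omega 0)
    (x : {ffun 'I_m.+1 -> R[i]})
    (hx : exists S : {set 'I_m.+1}, #|S| = s /\ carried_by x S) :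
  unique_minimal_extension Omega x.
Proof.
case: hx => S [cS xS] y yx yxO; set z := y - x.
have z0 w : w \in Omega -> fourier z w = 0.
  by move=> wO; rewrite fourierB yxO // subrr.
have zN0 : exists t, z t != 0.
  apply/existsP; apply: contra_notT yx => /existsPn zE.
  apply/subr0_eq/ffunP => t; rewrite [RHS]ffunE; apply/eqP/negPn/zE.
have yE t : y t = x t + z t by rewrite !ffunE addrC subrK.
rewrite /l1norm [ltRHS](eq_bigr _ (fun t _ => congr1 _ (yE t))).
apply: ltr_sum_normD xS _; apply: null_space_property zN0.
by rewrite cS; apply: coherence_bound z0 => // t /hK /ltW.
Qed.
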